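(* There is an absolute constant $C>0$ such that the following holds. Let $f:\mathbb{R}^d\to\mathbb{R}$ be differentiable, attain its minimum $f^*:=\min_{x\in\mathbb{R}^d}f(x)$, and be $L$-smooth ($L>0$), i.e. $\|\nabla f(x)-\nabla f(y)\|\le L\|x-y\|$ for all $x,y\in\mathbb{R}^d$. Let the oracle noise satisfy $|\delta(x)|^2\le\Delta^2$ for all $x\in\mathbb{R}^d$ ($\Delta>0$). Let $\tau>0$ and let $(x^k)_{k\ge0}$ be generated by GD via JAGUAR (see context) with smoothing parameter $\tau$, any $x^0\in\mathbb{R}^d$ and constant step size $\gamma=\frac{1}{4dL}$. Then for every $N\ge0$ $$\mathbb{E}\big[\|\nabla f(\widehat x_N)\|^2\big]\le C\left(\frac{dL\Phi_0}{N+1}+dL^2\tau^2+\frac{d\Delta^2}{\tau^2}\right),$$ where $\widehat x_N$ is chosen uniformly at random from $\{x^k\}_{k=0}^N$ (with the index uniform on $\{0,\dots,N\}$ and independent of the algorithm) and $\Phi_0:=f(x^0)-f^*+d\gamma\|h^0-\nabla f(x^0)\|^2$.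
   Context: $\|\cdot\|$ is the Euclidean norm on $\mathbb{R}^d$ and $e_1,\dots,e_d$ the standard basis. $\delta:\mathbb{R}^d\to\mathbb{R}$ is the oracle noise; only the noisy values $f_\delta(x):=f(x)+\delta(x)$ are available. Full approximation: $\widetilde\nabla f_\delta(x):=\sum_{i=1}^d\frac{f_\delta(x+\tau e_i)-f_\delta(x-\tau e_i)}{2\tau}e_i$. GD via JAGUAR: start from $x^0\in\mathbb{R}^d$, $h^0=\widetilde\nabla f_\delta(x^0)$. For $k=0,1,2,\dots$: sample $i_k$ uniformly from $\{1,\dots,d\}$, independently of everything before; set $h^{k+1}=h^k-\langle h^k,e_{i_k}\rangle e_{i_k}+\frac{f_\delta(x^k+\tau e_{i_k})-f_\delta(x^k-\tau e_{i_k})}{2\tau}e_{i_k}$; set $x^{k+1}=x^k-\gamma h^{k+1}$. The expectation is over all randomness. *)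

(* Defs.v *)
(* MathComp / MathComp-Analysis. *)
From HB Require Import structures.
From mathcomp Require Import all_boot all_order all_algebra.
From mathcomp Require Import all_classical all_reals all_analysis.

Set Implicit Arguments.
Unset Strict Implicit.
Unset Printing Implicit Defensive.

Import Order.TTheory GRing.Theory Num.Theory.
Import numFieldNormedType.Exports.

Local Open Scope classical_set_scope.
Local Open Scope ring_scope.

Section Euclidean.
Variables (R : realType) (d : nat).
Implicit Types (u v x y : 'rV[R]_d) (f : 'rV[R]_d -> R).

Definition basis_vec (i : 'I_d) : 'rV[R]_d := delta_mx 0 i.

Definition dot u v : R := \sum_(i < d) u 0 i * v 0 i.

(* The library norm `|u| on 'rV[R]_d is the sup norm, hence this definition. *)
Definition enorm u : R := Num.sqrt (dot u u).

(* This is the gradient only where f is differentiable. *)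
Definition grad f x : 'rV[R]_d := \row_(i < d) 'D_(basis_vec i) f x.

Definition smooth (L : R) f :=
  (forall x, differentiable f x) /\
  (forall x y, enorm (grad f x - grad f y) <= L * enorm (x - y)).

Definition is_minimum f (m : R) := (exists x, f x = m) /\ (forall x, m <= f x).

End Euclidean.

Section Jaguar.
Variables (R : realType) (d : nat).
Implicit Types (x h : 'rV[R]_d) (g : 'rV[R]_d -> R).

Definition central_diff g (tau : R) x (i : 'I_d) : R :=
  (g (x + tau *: basis_vec R i) - g (x - tau *: basis_vec R i)) / (2 * tau).

Definition full_approx g (tau : R) x : 'rV[R]_d :=
  \sum_(i < d) central_diff g tau x i *: basis_vec R i.

Definition jaguar_h g (tau : R) x h (i : 'I_d) : 'rV[R]_d :=
  h - dot h (basis_vec R i) *: basis_vec R i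
    + central_diff g tau x i *: basis_vec R i.

(* The pair (x^k, h^k) along a fixed sequence s of sampled coordinates. *)
Fixpoint jaguar g (tau gamma : R) x0 (s : nat -> 'I_d) (k : nat) :
    'rV[R]_d * 'rV[R]_d :=
  if k is k'.+1 then
    let: (x, h) := jaguar g tau gamma x0 s k' in
    let h' := jaguar_h g tau x h (s k') in
    (x - gamma *: h', h')
  else (x0, full_approx g tau x0).

End Jaguar.

Section Sampling.
Variables (disp : measure_display) (T : measurableType disp) (R : realType).
Variable P : probability T R.

(* The sigma-algebra generated by a random variable X with values in a finite
   type Y, every subset of Y being measurable. *)
Definition sigma_rv (Y : finType) (X : T -> Y) : set_system T :=
  preimage_set_system setT X [set: set Y].

(* The smallest sigma-algebra making all X j with j in J measurable. *)
Definition sigma_family (Y : finType) (X : nat -> T -> Y) (J : set nat) :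
    set_system T :=
  <<s \bigcup_(j in J) sigma_rv (X j) >>.

Definition independent_systems (F G : set_system T) :=
  forall A B, F A -> G B -> P (A `&` B) = (P A * P B)%E.

Definition uniform_rv n (X : T -> 'I_n) :=
  (sigma_rv X `<=` measurable) /\
  (forall j, P (X @^-1` [set j]) = (n%:R^-1)%:E).

Definition uniform_coordinates d (i : nat -> T -> 'I_d) :=
  forall k, uniform_rv (i k) /\
    independent_systems (sigma_rv (i k)) (sigma_family i [set j | (j < k)%N]).

End Sampling.

(* Main.v *)
Require Import Defs.
From HB Require Import structures.
From mathcomp Require Import all_boot all_order all_algebra.
From mathcomp Require Import all_classical all_reals all_analysis.
From mathcomp Require Import measurable_realfun ring lra.

Import Order.TTheory GRing.Theory Num.Theory.
Import numFieldNormedType.Exports.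

Local Open Scope classical_set_scope.
Local Open Scope ring_scope.

(* The Lyapunov function is [f x - f* + d gamma |h - grad f x|^2].  One step
   refreshes a uniformly random coordinate of [h], so the mean of
   [|h' - grad f x|^2] is [(1 - 1/d) |h - grad f x|^2] plus the mean squared
   error of the central differences, each coordinate of which is at most
   [B = L^2 tau^2 / 2 + 2 Delta^2 / tau^2].  With the descent inequality this
   gives E[lyapunov'] + gamma/2 |grad f x|^2 <= lyapunov + gamma (d + 1) B, which
   telescopes.  All the random quantities are functions of the finitely valued
   history of sampled coordinates, so expectations reduce to finite sums, and
   independence is used only on the atoms of the history. *)

(** * Euclidean inner product and norm *)

Section Euclid.
Context {R : realType} {d : nat}.
Implicit Types (a : R) (u v w x y : 'rV[R]_d) (f : 'rV[R]_d -> R).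

Lemma dotC u v : dot u v = dot v u.
Proof. by apply: eq_bigr => i _; rewrite mulrC. Qed.

Lemma dotDl u v w : dot (u + v) w = dot u w + dot v w.
Proof. by rewrite -big_split; apply: eq_bigr => i _; rewrite mxE mulrDl. Qed.

Lemma dotZl a u v : dot (a *: u) v = a * dot u v.
Proof. by rewrite mulr_sumr; apply: eq_bigr => i _; rewrite mxE mulrA. Qed.

Lemma dotDr u v w : dot u (v + w) = dot u v + dot u w.
Proof. by rewrite dotC dotDl !(dotC u). Qed.

Lemma dotZr a u v : dot u (a *: v) = a * dot u v.
Proof. by rewrite dotC dotZl dotC. Qed.

Lemma dotNl u v : dot (- u) v = - dot u v.
Proof. by rewrite -scaleN1r dotZl mulN1r. Qed.

Lemma dotNr u v : dot u (- v) = - dot u v.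
Proof. by rewrite dotC dotNl dotC. Qed.

Lemma dot_basis_vec u (i : 'I_d) : dot u (basis_vec R i) = u 0 i.
Proof.
rewrite /dot (bigD1 i)//= big1 ?addr0 => [|j ji].
  by rewrite mxE !eqxx mulr1.
by rewrite mxE (negbTE ji) andbF mulr0.
Qed.

Lemma dot_ge0 u : 0 <= dot u u.
Proof. by apply: sumr_ge0 => i _; rewrite -expr2 sqr_ge0. Qed.

Lemma enorm_ge0 u : 0 <= enorm u.
Proof. exact: sqrtr_ge0. Qed.

Lemma sqr_enorm u : enorm u ^+ 2 = dot u u.
Proof. by rewrite sqr_sqrtr ?dot_ge0. Qed.

Lemma enormZ a u : enorm (a *: u) = `|a| * enorm u.
Proof.
by rewrite /enorm dotZl dotZr mulrA -expr2 sqrtrM ?sqr_ge0// sqrtr_sqr.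
Qed.

Lemma enormN u : enorm (- u) = enorm u.
Proof. by rewrite -scaleN1r enormZ normrN1 mul1r. Qed.

Lemma enorm_basis_vec (i : 'I_d) : enorm (basis_vec R i) = 1.
Proof. by rewrite /enorm dot_basis_vec mxE !eqxx sqrtr1. Qed.

Lemma enorm_eq0 u : enorm u = 0 -> u = 0.
Proof.
move=> u0; have u2 : dot u u = 0 by rewrite -sqr_enorm u0 expr0n.
apply/rowP => i; rewrite mxE; apply/eqP; rewrite -sqrf_eq0 expr2; apply/eqP.
by move: u2 => /psumr_eq0P -> // j _; rewrite -expr2 sqr_ge0.
Qed.

Lemma dot0l v : dot 0 v = 0.
Proof. by rewrite -(scale0r (0 : 'rV_d)) dotZl mul0r. Qed.

(** Cauchy-Schwarz: expand [0 <= | |v| u - |u| v |^2] and divide by [|u| |v|], the zero vectors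
    being treated apart. *)
Lemma dot_le_enormM u v : dot u v <= enorm u * enorm v.
Proof.
have [/enorm_eq0 ->|v0] := eqVneq (enorm v) 0.
  by rewrite dotC dot0l mulr_ge0// enorm_ge0.
have [/enorm_eq0 ->|u0] := eqVneq (enorm u) 0.
  by rewrite dot0l mulr_ge0// enorm_ge0.
have v_gt0 : 0 < enorm v by rewrite lt_neqAle eq_sym v0 enorm_ge0.
have u_gt0 : 0 < enorm u by rewrite lt_neqAle eq_sym u0 enorm_ge0.
have := dot_ge0 (enorm v *: u - enorm u *: v).
rewrite !dotDl !dotDr !dotNl !dotNr !dotZl !dotZr -!sqr_enorm (dotC v u).
set p := enorm u in u_gt0 *; set q := enorm v in v_gt0 *.
have pq : 0 < p * q by rewrite mulr_gt0.
move=> H; rewrite -(ler_pM2l pq); nra.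
Qed.

(** Young's inequality with a free weight: expand [0 <= |b u - v|^2] and divide by [b]. *)
Lemma enormD_sqr_le b u v : 0 < b ->
  enorm (u + v) ^+ 2 <= (1 + b) * enorm u ^+ 2 + (1 + b^-1) * enorm v ^+ 2.
Proof.
move=> b0; have := dot_ge0 (b *: u - v).
rewrite !sqr_enorm !dotDl !dotDr !dotNl !dotNr !dotZl !dotZr (dotC v u) => H.
have := mulr_ge0 (ltW (etrans (invr_gt0 b) b0)) H.
have bb : b^-1 * b = 1 by rewrite mulVf ?gt_eqF.
move: bb; set c := b^-1 => bb.
rewrite !mulrDr !mulrN !mulrA bb; lra.
Qed.

(** * Gradients and quadratic bounds for smooth functions *)

Lemma derive_dot f x v : differentiable f x -> 'D_v f x = dot (grad f x) v.
Proof.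
move=> df; rewrite deriveE// {1}(row_sum_delta v) linear_sum.
apply: eq_bigr => i _.
by rewrite linearZ /= mxE deriveE// mulrC.
Qed.

(** The difference quotient of the restriction to the line is literally that of [f] at [x + t v]
    along [v], so no chain rule is involved. *)
Lemma is_derive_line f x v (t : R) : (forall y, differentiable f y) ->
  is_derive t (1 : R) (fun s => f (x + s *: v)) ('D_v f (x + t *: v)).
Proof.
move=> df.
have E : (fun h : R => h^-1 *: (((fun s => f (x + s *: v)) \o shift t) (h *: 1)
            - f (x + t *: v)))
       = (fun h : R => h^-1 *: ((f \o shift (x + t *: v)) (h *: v)
            - f (x + t *: v))).
  apply/funext => h /=; congr (_ *: (f _ - _)).
  by rewrite scalerDl -scalerA scale1r addrCA.
have := @diff_derivable _ _ _ f (x + t *: v) v (df _).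
rewrite /derivable -E => D; split; first exact: D.
by rewrite /derive E.
Qed.

(** The mean value theorem on [0, 1] is applied to [g], the restriction of [f] to the segment minus
    its quadratic model. At the intermediate point [c], the derivative is [<grad f (x + c v) - grad
    f x, v> - c L |v|^2], which is nonpositive by Cauchy-Schwarz and the Lipschitz bound. *)
Lemma smooth_upper (L : R) f x v : smooth L f ->
  f (x + v) <= f x + dot (grad f x) v + L / 2 * enorm v ^+ 2.
Proof.
move=> [df Lf].
pose g (t : R) := f (x + t *: v) - (t * dot (grad f x) v + t ^+ 2 * (L / 2 * enorm v ^+ 2)).
pose dg (t : R) := 'D_v f (x + t *: v) - (dot (grad f x) v + (2 * t) * (L / 2 * enorm v ^+ 2)).
have gD (t : R) : is_derive t (1:R) g (dg t).
  have D := is_derive_line f x v t df.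
  apply: is_derive_eq.
  rewrite /dg /GRing.scale /=; ring.
have [c] : exists2 c, c \in `]0, 1[%R & g 1 - g 0 = dg c * (1 - 0).
  apply: MVT => //; apply: continuous_subspaceT => t.
  apply: differentiable_continuous.
  by apply/derivable1_diffP; have [] := gD t.
rewrite in_itv/= => /andP[c0 c1].
rewrite subr0 mulr1 /g !scale1r !scale0r addr0.
suff : dg c <= 0 by lra.
rewrite /dg derive_dot//.
have := dot_le_enormM (grad f (x + c *: v) - grad f x) v.
rewrite dotDl dotNl.
have := Lf (x + c *: v) x; rewrite (addrC x) addrK enormZ gtr0_norm//.
move=> /(ler_wpM2r (enorm_ge0 v)); rewrite (addrC _ x); lra.
Qed.

Lemma grad_opp f x : differentiable f x -> grad (- f) x = - grad f x.
Proof.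
by move=> df; apply/rowP => i; rewrite !mxE deriveN//; exact: diff_derivable.
Qed.

Lemma smooth_opp (L : R) f : smooth L f -> smooth L (- f).
Proof.
move=> [df Lf]; split=> [x|x y]; first exact: differentiableN.
by rewrite !grad_opp// -opprD enormN.
Qed.

Lemma smooth_lower (L : R) f x v : smooth L f ->
  f x + dot (grad f x) v - L / 2 * enorm v ^+ 2 <= f (x + v).
Proof.
move=> Lf; have := smooth_upper _ _ x v (smooth_opp _ _ Lf).
rewrite grad_opp; last by case: Lf.
by rewrite dotNl !fctE; lra.
Qed.

(** * Error of the noisy central differences *)

(** The quadratic bounds at [x + tau e_i] and [x - tau e_i] put the smoothing error within
    [L tau / 2], and the two noise values add at most [Delta / tau]. *)
Lemma central_diff_err (L Delta tau : R) f (delta : 'rV[R]_d -> R) x i :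
  0 < tau -> 0 < Delta -> smooth L f -> (forall x, `|delta x| ^+ 2 <= Delta ^+ 2) ->
  (central_diff (fun x => f x + delta x) tau x i - grad f x 0 i) ^+ 2 <=
  L ^+ 2 * tau ^+ 2 / 2 + 2 * (Delta ^+ 2 / tau ^+ 2).
Proof.
move=> t0 D0 Lf Hd.
have dle y : - Delta <= delta y <= Delta.
  by rewrite -ler_norml -(@ler_pXn2r _ 2) ?nnegrE ?normr_ge0 ?(ltW D0).
have U1 := smooth_upper _ _ x (tau *: basis_vec R i) Lf.
have U2 := smooth_upper _ _ x (- (tau *: basis_vec R i)) Lf.
have W1 := smooth_lower _ _ x (tau *: basis_vec R i) Lf.
have W2 := smooth_lower _ _ x (- (tau *: basis_vec R i)) Lf.
move: U1 U2 W1 W2; rewrite !enormN !dotNr !dotZr dot_basis_vec.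
rewrite !enormZ enorm_basis_vec gtr0_norm// mulr1 /central_diff /=.
set a := f (x + _); set b := f (x - _); set g := grad f x 0 i.
have /andP[] := dle (x + tau *: basis_vec R i).
have /andP[] := dle (x - tau *: basis_vec R i).
set p := delta (x - _); set q := delta (x + _).
move=> p1 p2 q1 q2 U1 U2 W1 W2.
(* With [r = Delta / tau], the bounds on [2 tau e] contain no division and become linear in
   products. *)
have [r rE] : exists r, Delta = r * tau.
  by exists (Delta / tau); rewrite divfK ?gt_eqF.
have -> : Delta ^+ 2 / tau ^+ 2 = r ^+ 2.
  by rewrite rE exprMn mulfK ?expf_neq0 ?gt_eqF.
set e := (X in X ^+ 2).
have eE : 2 * tau * e = (a + q - (b + p)) - 2 * tau * g.
  by rewrite /e; field; rewrite gt_eqF.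
have t2 : 0 < 2 * tau by lra.
have e1 : e <= L * tau / 2 + r.
  by rewrite -(ler_pM2l t2) eE; rewrite rE in p1 p2 q1 q2; lra.
have e2 : - (L * tau / 2 + r) <= e.
  by rewrite -(ler_pM2l t2) eE; rewrite rE in p1 p2 q1 q2; lra.
(* The product gives [e^2 <= (L tau / 2 + r)^2]; the square added below bounds this by
   [2 (L tau / 2)^2 + 2 r^2]. *)
have : 0 <= (L * tau / 2 + r - e) * (e + (L * tau / 2 + r)).
  by rewrite mulr_ge0//; lra.
have := sqr_ge0 (L * tau / 2 - r); lra.
Qed.

(** * The JAGUAR update and the Lyapunov descent *)

(** Update [i] replaces coordinate [i] of [h - u] by the error of the central difference. Over all
    [i] each coordinate is dropped exactly once, so one of the [d] copies of [|h - u|^2]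
    disappears. *)
Lemma sum_sqr_jaguar_h (g : 'rV[R]_d -> R) tau x h u :
  \sum_(i < d) enorm (jaguar_h g tau x h i - u) ^+ 2 =
  (d%:R - 1) * enorm (h - u) ^+ 2
  + \sum_(i < d) (central_diff g tau x i - u 0 i) ^+ 2.
Proof.
have E i : enorm (jaguar_h g tau x h i - u) ^+ 2 =
    enorm (h - u) ^+ 2 - (h - u) 0 i ^+ 2 + (central_diff g tau x i - u 0 i) ^+ 2.
  pose b := basis_vec R i.
  have -> : jaguar_h g tau x h i - u = (h - u) + (central_diff g tau x i - h 0 i) *: b.
    by rewrite /jaguar_h dot_basis_vec; apply/rowP => k; rewrite !mxE; ring.
  have bb : dot b b = 1 by rewrite dot_basis_vec mxE !eqxx.
  have -> : central_diff g tau x i - u 0 i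
      = (h - u) 0 i + (central_diff g tau x i - h 0 i) by rewrite !mxE; ring.
  move: (h - u) (central_diff _ _ _ _ - _) => v c.
  rewrite !sqr_enorm dotDl !dotDr !dotZl !dotZr (dotC b v) bb dot_basis_vec; ring.
under eq_bigr do rewrite E.
rewrite big_split/= sumrB sumr_const card_ord -[_ *+ d]mulr_natl; congr (_ + _).
rewrite mulrBl mul1r; congr (_ - _).
by rewrite sqr_enorm; apply: eq_bigr => i _; rewrite expr2.
Qed.

Definition jaguar_step (g : 'rV[R]_d -> R) (tau gamma : R)
    (z : 'rV[R]_d * 'rV[R]_d) (i : 'I_d) : 'rV[R]_d * 'rV[R]_d :=
  let h' := jaguar_h g tau z.1 z.2 i in (z.1 - gamma *: h', h').

Lemma jaguarS (g : 'rV[R]_d -> R) tau gamma x0 (s : nat -> 'I_d) k :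
  jaguar g tau gamma x0 s k.+1 =
  jaguar_step g tau gamma (jaguar g tau gamma x0 s k) (s k).
Proof. by rewrite /jaguar_step /=; case: (jaguar _ _ _ _ _ k). Qed.

Lemma eq_jaguar (g : 'rV[R]_d -> R) tau gamma x0 (s t : nat -> 'I_d) k :
  (forall j, (j < k)%N -> s j = t j) ->
  jaguar g tau gamma x0 s k = jaguar g tau gamma x0 t k.
Proof.
elim: k => // k IH st; rewrite !jaguarS st// IH// => j jk.
by apply: st; exact: ltnW.
Qed.

Definition lyapunov f (fstar gamma : R) (z : 'rV[R]_d * 'rV[R]_d) : R :=
  f z.1 - fstar + d%:R * gamma * enorm (z.2 - grad f z.1) ^+ 2.

Lemma lyapunov_ge0 f fstar gamma z : is_minimum f fstar -> 0 <= gamma ->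
  0 <= lyapunov f fstar gamma z.
Proof.
move=> [_ fmin] g0; apply: addr_ge0; first by rewrite subr_ge0.
by apply: mulr_ge0; [exact: mulr_ge0|exact: sqr_ge0].
Qed.

(* Young's inequality for [h - grad f x'] is used with parameter [1 / (2 d)]: it
   costs a factor [1 + 1 / (2 d)], less than the contraction [1 - 1 / d] that
   resampling one coordinate gains, while the term [(1 + 2 d) L^2 |x' - x|^2]
   is absorbed by the [- |x' - x|^2 / (2 gamma)] of the descent inequality. *)
Lemma lyapunov_descent f fstar (L gamma : R) x h :
  (0 < d)%N -> 0 < L -> smooth L f -> gamma = 1 / (4 * d%:R * L) ->
  lyapunov f fstar gamma (x - gamma *: h, h) <=
  f x - fstar - gamma / 2 * enorm (grad f x) ^+ 2
  + gamma * (d%:R + 1) * enorm (h - grad f x) ^+ 2.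
Proof.
move=> d0 L0 Lf gE.
have n1 : 1 <= d%:R :> R by rewrite ler1n.
have n0 : 0 < d%:R :> R by rewrite ltr0n.
have gL : 4 * d%:R * (L * gamma) = 1.
  by rewrite gE; field; rewrite !gt_eqF.
have g0 : 0 < gamma by rewrite gE divr_gt0// !mulr_gt0.
rewrite /lyapunov /=.
have [x' x'E] : exists x', x' = x - gamma *: h by exists (x - gamma *: h).
rewrite -x'E.
have b0 : 0 < (2 * d%:R)^-1 :> R by rewrite invr_gt0 mulr_gt0.
have := enormD_sqr_le _ (h - grad f x) (grad f x - grad f x') b0.
rewrite subrKA invrK => Y.
have := smooth_upper _ _ x (- (gamma *: h)) Lf.
rewrite -x'E dotNr dotZr enormN enormZ (gtr0_norm g0) exprMn => U.
have : enorm (grad f x - grad f x') ^+ 2 <= L ^+ 2 * (gamma ^+ 2 * enorm h ^+ 2).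
  have [_ /(_ x x')] := Lf.
  rewrite {2}x'E opprB addrCA subrr addr0 enormZ (gtr0_norm g0) => HL.
  by rewrite -!exprMn lerXn2r ?nnegrE ?enorm_ge0// !mulr_ge0 ?enorm_ge0 ?(ltW g0) ?(ltW L0).
have : enorm (h - grad f x) ^+ 2 = enorm h ^+ 2 - 2 * dot (grad f x) h + enorm (grad f x) ^+ 2.
  by rewrite !sqr_enorm !dotDl !dotDr !dotNl !dotNr (dotC h (grad f x)); ring.
have := sqr_ge0 (enorm h).
move: Y U.
set G' := enorm (h - grad f x') ^+ 2; set H := enorm (h - grad f x) ^+ 2.
set V := enorm (grad f x - grad f x') ^+ 2.
set m := enorm h ^+ 2; set q := dot _ _; set a := enorm (grad f x) ^+ 2.
move=> Y U m0 HE VL.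
have dg : 0 <= d%:R * gamma by rewrite mulr_ge0// (ltW g0).
have Y1 : d%:R * gamma * G' <= gamma * (d%:R + 1 / 2) * H + d%:R * gamma * (1 + 2 * d%:R) * V.
  apply: le_trans (ler_wpM2l dg Y) _.
  rewrite le_eqVlt; apply/orP; left; apply/eqP; field.
  by rewrite gt_eqF.
(* The constant comes from [1 + 2 d <= 3 d] and [d L gamma = 1 / 4]:
   [d (1 + 2 d) (L gamma)^2 <= 3 / 16]. *)
have V1 : d%:R * gamma * (1 + 2 * d%:R) * V <= gamma * (3 / 16) * m.
  have c0 : 0 <= d%:R * gamma * (1 + 2 * d%:R) by rewrite mulr_ge0// addr_ge0// mulr_ge0.
  apply: le_trans (ler_wpM2l c0 VL) _.
  have -> : d%:R * gamma * (1 + 2 * d%:R) * (L ^+ 2 * (gamma ^+ 2 * m)) =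
    d%:R * (1 + 2 * d%:R) * (L * gamma) ^+ 2 * (gamma * m) by ring.
  have -> : gamma * (3 / 16) * m = 3 / 16 * (gamma * m) by ring.
  rewrite ler_wpM2r ?(mulr_ge0 (ltW g0) m0)//.
  have -> : 3 / 16 = 3 * (d%:R * (L * gamma)) ^+ 2.
    have -> : d%:R * (L * gamma) = 1 / 4 by lra.
    by field.
  have := sqr_ge0 (L * gamma); set e := (L * gamma) ^+ 2 => e0.
  have -> : (d%:R * (L * gamma)) ^+ 2 = d%:R * d%:R * e by rewrite /e; ring.
  have : 0 <= e * (d%:R * (d%:R - 1)).
    by do 2!apply: mulr_ge0 => //; rewrite subr_ge0.
  lra.
have Lg : L * gamma <= 1 / 4.
  have : 0 <= (d%:R - 1) * (L * gamma).
    by apply: mulr_ge0; [rewrite subr_ge0|rewrite ltW// mulr_gt0].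
  lra.
have M : L / 2 * (gamma ^+ 2 * m) <= 1 / 8 * (gamma * m).
  have -> : L / 2 * (gamma ^+ 2 * m) = (L * gamma) / 2 * (gamma * m) by ring.
  by rewrite ler_wpM2r ?(mulr_ge0 (ltW g0) m0)//; lra.
have gm : 0 <= gamma * m by rewrite mulr_ge0// (ltW g0).
(* Expanding half a copy of [H] supplies the [- gamma q] of the descent inequality and leaves
   [gamma m / 2], enough to absorb [3 / 16 + 1 / 8] times [gamma m]. *)
have -> : gamma * (d%:R + 1) * H = gamma * (d%:R + 1 / 2) * H + gamma / 2 * (m - 2 * q + a).
  by rewrite -HE; field.
lra.
Qed.

(** Averaging the descent over [i] leaves the weight [gamma (d + 1) (d - 1) / d] on
    [|h - grad f x|^2]. As [(d + 1) (d - 1) <= d^2], this is at most the weight [d gamma] of the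
    Lyapunov function. *)
Lemma lyapunov_mean_step f (delta : 'rV[R]_d -> R) fstar (L Delta tau gamma : R) z :
  (0 < d)%N -> 0 < L -> 0 < Delta -> 0 < tau -> smooth L f ->
  (forall x, `|delta x| ^+ 2 <= Delta ^+ 2) -> gamma = 1 / (4 * d%:R * L) ->
  d%:R^-1 * \sum_(i < d)
    lyapunov f fstar gamma (jaguar_step (fun x => f x + delta x) tau gamma z i)
  + gamma / 2 * enorm (grad f z.1) ^+ 2 <=
  lyapunov f fstar gamma z
  + gamma * (d%:R + 1) * (L ^+ 2 * tau ^+ 2 / 2 + 2 * (Delta ^+ 2 / tau ^+ 2)).
Proof.
move=> d0 L0 D0 t0 Lf Hd gE.
have n0 : 0 < d%:R :> R by rewrite ltr0n.
have n1 : 1 <= d%:R :> R by rewrite ler1n.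
have g0 : 0 < gamma by rewrite gE divr_gt0// !mulr_gt0.
case: z => x h; set B := L ^+ 2 * _ / 2 + _.
set fd := fun x => _.
have S1 : \sum_(i < d) lyapunov f fstar gamma (jaguar_step fd tau gamma (x, h) i) <=
   d%:R * (f x - fstar - gamma / 2 * enorm (grad f x) ^+ 2)
   + gamma * (d%:R + 1) * \sum_(i < d) enorm (jaguar_h fd tau x h i - grad f x) ^+ 2.
  rewrite mulr_natl -[X in _ *+ X]card_ord -sumr_const mulr_sumr -big_split/=.
  by apply: ler_sum => i _; exact: (lyapunov_descent _ _ L).
have S2 : \sum_(i < d) (central_diff fd tau x i - grad f x 0 i) ^+ 2 <= d%:R * B.
  rewrite mulr_natl -[X in _ *+ X]card_ord -sumr_const.
  by apply: ler_sum => i _; exact: central_diff_err.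
rewrite sum_sqr_jaguar_h in S1.
rewrite -lerBrDr ler_pdivrMl// /lyapunov /=.
apply: le_trans S1 _.
have gd : 0 <= gamma * (d%:R + 1) by rewrite mulr_ge0 ?addr_ge0 ?(ltW g0).
have := ler_wpM2l gd S2.
have := sqr_ge0 (enorm (h - grad f x)).
move/(mulr_ge0 (ltW g0)).
set E := _ ^+ 2; set S := \sum_(_ < _) _; set a := enorm _ ^+ 2.
lra.
Qed.

End Euclid.

(** * Expectations of functions of finitely valued random variables *)

Section FinitelyValued.
Context {R : realType} {disp : measure_display} {T : measurableType disp}.
Context (P : probability T R).

Lemma measurable_fun_comp_fin (Y : finType) (X : T -> Y) (psi : Y -> R) :
  (forall y, measurable (X @^-1` [set y])) ->
  measurable_fun setT (fun w => psi (X w)).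
Proof.
move=> mX _ B mB; rewrite setTI.
have -> : (fun w => psi (X w)) @^-1` B =
    \big[setU/set0]_(y <- enum [set: Y]%SET | `[< B (psi y) >]) (X @^-1` [set y]).
  apply/seteqP; split=> w /=; rewrite -bigcup_seq_cond/=.
    by move=> BX; exists (X w) => //=; rewrite mem_enum inE; exact/asboolP.
  by move=> [y /= /andP[_ /asboolP By] ->].
by apply: bigsetU_measurable.
Qed.

Lemma integral_indic_fin (Y : finType) (X : T -> Y) (psi : Y -> R) (A : set T) :
  (forall y, measurable (X @^-1` [set y])) -> measurable A ->
  (forall y, 0 <= psi y) ->
  (\int[P]_w ((\1_A w * psi (X w))%:E) =
   \sum_(y : Y) (psi y)%:E * P (A `&` X @^-1` [set y]))%E.
Proof.
move=> mX mA psi0.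
have mAX y : measurable (A `&` X @^-1` [set y]) by exact: measurableI.
transitivity (\int[P]_w (\sum_(y : Y) ((psi y)%:E * (\1_(A `&` X @^-1` [set y]) w)%:E)))%E.
  apply: eq_integral => w _.
  rewrite (bigD1 (X w))//= big1 ?adde0 => [|y yX].
    rewrite -EFinM mulrC !indicE in_setI; congr (_ * (nat_of_bool _)%:R)%:E.
    by rewrite [X in _ && X]mem_set// andbT.
  rewrite indicE memNset ?mule0//= => -[_ /= yE].
  by move: yX; rewrite yE eqxx.
rewrite ge0_integral_sum//.
- apply: eq_bigr => y _; rewrite ge0_integralZl//.
  + by rewrite integral_indic// setIT.
  + by apply/measurable_EFinP; exact: measurable_indic.
  + by rewrite lee_fin.
- move=> y; apply: emeasurable_funM; first exact: measurable_cst.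
  by apply/measurable_EFinP; exact: measurable_indic.
- by move=> y w _; rewrite mule_ge0 ?lee_fin.
Qed.

Lemma integral_indic_indep (Y : finType) (X : T -> Y) (psi : Y -> R) (A : set T) (p : R) :
  (forall y, measurable (X @^-1` [set y])) -> measurable A ->
  (forall y, 0 <= psi y) -> P A = p%:E ->
  (forall y, P (A `&` X @^-1` [set y]) = (P A * P (X @^-1` [set y]))%E) ->
  (\int[P]_w ((\1_A w * psi (X w))%:E) = p%:E * \int[P]_w ((psi (X w))%:E))%E.
Proof.
move=> mX mA psi0 PA ind.
rewrite integral_indic_fin//.
(* Inserting the indicator of the whole space lets the same finite sum formula compute the
   unrestricted integral. *)
transitivity (p%:E * \int[P]_w ((\1_setT w * psi (X w))%:E))%E; last first.
  by congr (_ * _)%E; apply: eq_integral => w _; rewrite indicT mul1r.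
rewrite integral_indic_fin// ge0_sume_distrr.
  by apply: eq_bigr => y _; rewrite ind PA setTI muleCA.
by move=> y _; rewrite mule_ge0 ?lee_fin.
Qed.

(** Split according to the value of [U]; on each piece the indicator of [U = j] factors out by
    independence from the atoms of [X]. *)
Lemma integral_uniform_indep n (Y : finType) (X : T -> Y) (U : T -> 'I_n)
    (phi : 'I_n -> Y -> R) (G : set_system T) :
  (forall y, measurable (X @^-1` [set y])) -> uniform_rv P U ->
  independent_systems P (sigma_rv U) G ->
  (forall y, G (X @^-1` [set y])) ->
  (forall j y, 0 <= phi j y) ->
  (\int[P]_w ((phi (U w) (X w))%:E) =
    \sum_(j < n) (n%:R^-1)%:E * \int[P]_w ((phi j (X w))%:E))%E.
Proof.
move=> mX [mU PU] ind GX phi0.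
have sU j : sigma_rv U (U @^-1` [set j]).
  by exists [set j] => //; rewrite setTI.
have mUj j : measurable (U @^-1` [set j]) by exact: mU.
have mphi j : measurable_fun setT (fun w => phi j (X w)).
  exact: measurable_fun_comp_fin.
transitivity (\int[P]_w (\sum_(j < n) (\1_(U @^-1` [set j]) w * phi j (X w))%:E))%E.
  apply: eq_integral => w _.
  rewrite (bigD1 (U w))//= big1 ?adde0 => [|j jU].
    by rewrite indicE mem_set ?mul1r.
  rewrite indicE memNset ?mul0r//= => jE.
  by move: jU; rewrite jE eqxx.
rewrite ge0_integral_sum//.
- apply: eq_bigr => j _; apply: integral_indic_indep => //.
  by move=> y; exact: ind.
- move=> j; apply/measurable_EFinP; apply: measurable_funM => //.
- by move=> j w _; rewrite lee_fin mulr_ge0.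
Qed.

End FinitelyValued.

(** * The history of sampled coordinates *)

Section History.
Context {R : realType} {disp : measure_display} {T : measurableType disp}.
Context (P : probability T R).
Context {d : nat} (i : nat -> T -> 'I_d).

(** A finite function type makes the history a finitely valued random variable. *)
Definition history k (w : T) : {ffun 'I_k -> 'I_d} := [ffun j : 'I_k => i j w].

(** An atom of the history is a finite intersection of generating events. The set [J] is the past
    for a sampling step and all of [nat] for the output index. *)
Lemma sigma_family_history k (J : set nat) y :
  [set j | (j < k)%N] `<=` J -> sigma_family i J (history k @^-1` [set y]).
Proof.
move=> kJ.
have -> : history k @^-1` [set y] = \big[setI/setT]_(j < k) (i j @^-1` [set y j]).
  apply/seteqP; split=> w; rewrite -bigcap_seq => /=.
    by move=> <- j _ /=; rewrite ffunE.
  by move=> H; apply/ffunP => j; rewrite ffunE; exact: (H j (mem_index_enum j)).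
pose G := \bigcup_(j in J) sigma_rv (i j).
apply: (@bigsetI_measurable _ (g_sigma_algebraType G)) => j _.
apply: sub_sigma_algebra; exists (j : nat); first exact/kJ/ltn_ord.
by exists [set y j] => //; rewrite setTI.
Qed.

End History.

(** * Expectations along the trajectory *)

Section JaguarExpectation.
Context {R : realType} {disp : measure_display} {T : measurableType disp}.
Context (P : probability T R).
Context {d : nat} (i : nat -> T -> 'I_d).
Context (unif : uniform_coordinates P i).
Context (g : 'rV[R]_d -> R) (tau gamma : R) (x0 : 'rV[R]_d).

Local Notation z k w := (jaguar g tau gamma x0 (i ^~ w) k).

Lemma jaguar_history k : (0 < d)%N ->
  exists zh : nat -> {ffun 'I_k -> 'I_d} -> 'rV[R]_d * 'rV[R]_d,
    forall m w, (m <= k)%N -> z m w = zh m (history i k w).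
Proof.
move=> d0.
(* Positions from [k] on receive the default coordinate 0, available since [0 < d]; states up to
   time [k] never read them. *)
exists (fun m y => jaguar g tau gamma x0
  (fun n => if insub n is Some j then y j else Ordinal d0) m) => m w mk.
apply: eq_jaguar => j jm.
have jk : (j < k)%N by exact: leq_trans mk.
by rewrite insubT ffunE.
Qed.

Lemma measurable_history k (y : {ffun 'I_k -> 'I_d}) :
  measurable (history i k @^-1` [set y]).
Proof.
have := sigma_family_history i k setT y (@subsetT _ _).
apply: smallest_sub; first exact: sigma_algebra_measurable.
by move=> A [j _ Aj]; have [[+ _] _] := unif j; exact.
Qed.

Lemma measurable_jaguar (phi : 'rV[R]_d * 'rV[R]_d -> R) k : (0 < d)%N ->
  measurable_fun setT (fun w => (phi (z k w))%:E).
Proof.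
move=> d0; have [zh zhE] := jaguar_history k d0.
under eq_fun do rewrite zhE//.
apply/measurable_EFinP.
apply: (measurable_fun_comp_fin _ _ (fun y => phi (zh k y))).
exact: measurable_history.
Qed.

(** A common bound [k] on the times [m j] makes all the states functions of one history. The lemma
    serves both the sampling step, with [m] constant, and the random output index, with
    [m j = j]. *)
Lemma integral_jaguar_uniform n (U : T -> 'I_n) (m : 'I_n -> nat) k (J : set nat)
    (phi : 'I_n -> 'rV[R]_d * 'rV[R]_d -> R) :
  (0 < d)%N -> uniform_rv P U ->
  independent_systems P (sigma_rv U) (sigma_family i J) ->
  [set j | (j < k)%N] `<=` J -> (forall j, (m j <= k)%N) ->
  (forall j y, 0 <= phi j y) ->
  (\int[P]_w ((phi (U w) (z (m (U w)) w))%:E) =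
   \sum_(j < n) (n%:R^-1)%:E * \int[P]_w ((phi j (z (m j) w))%:E))%E.
Proof.
move=> d0 uU ind kJ mk phi0; have [zh zhE] := jaguar_history k d0.
under eq_integral do rewrite zhE//.
rewrite (integral_uniform_indep P _ _ (history i k) U
  (fun j y => phi j (zh (m j) y)) (sigma_family i J))//.
- apply: eq_bigr => j _; congr (_ * _)%E.
  by apply: eq_integral => w _; rewrite zhE.
- exact: measurable_history.
- by move=> y; exact: sigma_family_history.
Qed.

(** This is the tower property, with the conditional expectation given the past written as an
    average over the next coordinate. *)
Lemma integral_jaguarS k (phi : 'rV[R]_d * 'rV[R]_d -> R) :
  (0 < d)%N -> (forall y, 0 <= phi y) ->
  (\int[P]_w ((phi (z k.+1 w))%:E) =
   \int[P]_w ((d%:R^-1 * \sum_(j < d) phi (jaguar_step g tau gamma (z k w) j))%:E))%E.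
Proof.
move=> d0 phi0; have [uk indk] := unif k.
under eq_integral do rewrite jaguarS.
rewrite (integral_jaguar_uniform _ _ (fun=> k) k _
  (fun j y => phi (jaguar_step g tau gamma y j)) d0 uk indk)//.
have md j := measurable_jaguar (fun y => phi (jaguar_step g tau gamma y j)) k d0.
rewrite -ge0_sume_distrr; last first.
  by move=> j _; apply: integral_ge0 => w _; rewrite lee_fin.
rewrite -ge0_integral_sum//; last by move=> j w _; rewrite lee_fin.
rewrite -ge0_integralZl//.
- by apply: eq_integral => w _; rewrite EFinM sumEFin.
- exact: emeasurable_sum.
- by move=> w _; apply: sume_ge0 => j _; rewrite lee_fin.
Qed.

Lemma telescope_integral (phi psi : 'rV[R]_d * 'rV[R]_d -> R) (c : R) n :
  (0 < d)%N -> 0 <= c -> (forall y, 0 <= phi y) -> (forall y, 0 <= psi y) ->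
  (forall y, d%:R^-1 * \sum_(j < d) phi (jaguar_step g tau gamma y j) + psi y
     <= phi y + c) ->
  (\int[P]_w ((phi (z n w))%:E) + \sum_(k < n) \int[P]_w ((psi (z k w))%:E) <=
   (phi (x0, full_approx g tau x0) + n%:R * c)%:E)%E.
Proof.
move=> d0 c0 phi0 psi0 H; elim: n => [|n IH].
  rewrite big_ord0 adde0 mul0r addr0 /= integral_cst//.
  by rewrite [X in (_ * X)%E]probability_setT mule1.
rewrite big_ord_recr/= addeCA integral_jaguarS//.
have mphi := measurable_jaguar phi n d0.
have mpsi := measurable_jaguar psi n d0.
pose A y := d%:R^-1 * \sum_(j < d) phi (jaguar_step g tau gamma y j).
have mA := measurable_jaguar A n d0.
have A0 y : 0 <= A y by rewrite mulr_ge0// sumr_ge0.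
have step : (\int[P]_w (A (z n w))%:E + \int[P]_w (psi (z n w))%:E <=
    \int[P]_w (phi (z n w))%:E + c%:E)%E.
  (* The constant is an integral because [P] has mass one; all terms are then integrals of
     nonnegative functions, compared without subtraction in the extended reals. *)
  have -> : (c%:E = \int[P]_w (cst c%:E w))%E.
    by rewrite integral_cst// [X in (_ * X)%E]probability_setT mule1.
  rewrite -ge0_integralD//; try by move=> w _; rewrite lee_fin.
  rewrite -ge0_integralD//; try by move=> w _; rewrite lee_fin.
  apply: ge0_le_integral => //.
  - by move=> w _; rewrite -EFinD lee_fin addr_ge0.
  - exact: emeasurable_funD.
  - exact: emeasurable_funD.
  - by move=> w _; rewrite -!EFinD lee_fin; exact: H.
apply: (le_trans (leeD2l _ step)).
rewrite addeCA addeA mulrSr mulrDl mul1r addrA EFinD.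
exact: leeD2r.
Qed.

End JaguarExpectation.

(** * The convergence bound *)

Theorem theorem3 (R : realType) :
  exists C : R, 0 < C /\
  forall (d : nat) (f delta : 'rV[R]_d -> R) (fstar L Delta tau gamma : R)
    (x0 : 'rV[R]_d)
    (disp : measure_display) (T : measurableType disp) (P : probability T R)
    (i : nat -> T -> 'I_d) (N : nat) (idx : T -> 'I_N.+1),
  let fdelta := fun x => f x + delta x in
  let xs := fun k w => (jaguar fdelta tau gamma x0 (i ^~ w) k).1 in
  let h0 := full_approx fdelta tau x0 in
  let Phi0 := f x0 - fstar + d%:R * gamma * enorm (h0 - grad f x0) ^+ 2 in
  (0 < d)%N -> 0 < L -> 0 < Delta -> 0 < tau ->
  smooth L f ->
  is_minimum f fstar ->
  (forall x, `|delta x| ^+ 2 <= Delta ^+ 2) ->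
  gamma = 1 / (4 * d%:R * L) ->
  uniform_coordinates P i ->
  uniform_rv P idx ->
  independent_systems P (sigma_rv idx) (sigma_family i setT) ->
  ('E_P[fun w => (enorm (grad f (xs (idx w) w)) ^+ 2)%R] <=
    (C * (d%:R * L * Phi0 / N.+1%:R + d%:R * L ^+ 2 * tau ^+ 2
          + d%:R * Delta ^+ 2 / tau ^+ 2))%:E)%E.
Proof.
(* The factor 8 arises from [2 / gamma = 8 d L], and again in the noise term of [2 (d + 1) B <= 4 d
   B = 2 d L^2 tau^2 + 8 d Delta^2 / tau^2]. *)
exists 8; split => // d f delta fstar L Delta tau gamma x0 disp T P i N idx
  fdelta xs h0 Phi0 d0 L0 D0 t0 Lf fmin Hd gE unif uidx ind.
have n0 : 0 < d%:R :> R by rewrite ltr0n.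
have n1 : 1 <= d%:R :> R by rewrite ler1n.
have g0 : 0 < gamma by rewrite gE divr_gt0// !mulr_gt0.
pose B := L ^+ 2 * tau ^+ 2 / 2 + 2 * (Delta ^+ 2 / tau ^+ 2).
have Lt0 : 0 <= L ^+ 2 * tau ^+ 2 by rewrite -exprMn sqr_ge0.
have Dt0 : 0 <= Delta ^+ 2 / tau ^+ 2 by rewrite -expr_div_n sqr_ge0.
have B0 : 0 <= B by rewrite /B; lra.
pose psi (y : 'rV[R]_d * 'rV[R]_d) := gamma / 2 * enorm (grad f y.1) ^+ 2.
have psi0 y : 0 <= psi y by apply: mulr_ge0; [rewrite divr_ge0// ltW|exact: sqr_ge0].
have c0 : 0 <= gamma * (d%:R + 1) * B.
  by apply: mulr_ge0 => //; apply: mulr_ge0; [exact: ltW|rewrite addr_ge0].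
have lyap0 y := lyapunov_ge0 f fstar gamma y fmin (ltW g0).
have := telescope_integral P i unif fdelta tau gamma x0 (lyapunov f fstar gamma) psi
  (gamma * (d%:R + 1) * B) N.+1 d0 c0 lyap0 psi0
  (fun y => lyapunov_mean_step f delta fstar L Delta tau gamma y d0 L0 D0 t0 Lf Hd gE).
set S := (\sum_(k < N.+1) _)%E => tele.
(* The expected Lyapunov value after [N + 1] steps is nonnegative and is dropped. *)
have S_le : (S <= (Phi0 + N.+1%:R * (gamma * (d%:R + 1) * B))%:E)%E.
  apply: le_trans tele; apply: leeDr.
  by apply: integral_ge0 => w _; rewrite lee_fin.
pose a (y : 'rV[R]_d * 'rV[R]_d) := enorm (grad f y.1) ^+ 2.
(* The uniform index turns the expectation into the average over the [N + 1] iterates; [2 / gamma]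
   undoes the factor [gamma / 2] in [psi]. *)
have -> : ('E_P[fun w => (enorm (grad f (xs (idx w) w)) ^+ 2)%R] =
    (N.+1%:R^-1 * (2 / gamma))%:E * S)%E.
  rewrite unlock.
  rewrite (integral_jaguar_uniform P i unif fdelta tau gamma x0 _ _
    (@nat_of_ord _) N.+1 _ (fun=> a) d0 uidx ind)//; first last.
  - by move=> j y; exact: sqr_ge0.
  - by move=> j; exact: ltnW.
  rewrite ge0_sume_distrr; last first.
    by move=> k _; apply: integral_ge0 => w _; rewrite lee_fin.
  apply: eq_bigr => k _; rewrite EFinM -muleA; congr (_ * _)%E.
  rewrite -ge0_integralZl//.
  - apply: eq_integral => w _; rewrite -EFinM; congr EFin.
    by rewrite /psi -/(a _); field; rewrite gt_eqF.
  - exact: measurable_jaguar.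
  - by move=> w _; rewrite lee_fin.
  - by rewrite lee_fin divr_ge0// ltW.
have c1 : 0 <= N.+1%:R^-1 * (2 / gamma).
  by rewrite mulr_ge0 ?invr_ge0// divr_ge0// ltW.
apply: le_trans (lee_wpmul2l _ S_le) _; first by rewrite lee_fin.
rewrite -EFinM lee_fin.
(* The [N + 1] accumulated error terms cancel against the averaging, and [4 d L gamma = 1] removes
   the step size. *)
have -> : N.+1%:R^-1 * (2 / gamma) * (Phi0 + N.+1%:R * (gamma * (d%:R + 1) * B)) =
    8 * (d%:R * L * Phi0 / N.+1%:R) + 2 * (d%:R + 1) * B.
  have -> : 2 / gamma = 8 * d%:R * L by rewrite gE; field; rewrite !gt_eqF.
  have dLg : 4 * d%:R * L * gamma = 1 by rewrite gE; field; rewrite !gt_eqF.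
  have nn : N.+1%:R != 0 :> R by rewrite pnatr_eq0.
  transitivity (8 * (d%:R * L * Phi0 / N.+1%:R) +
    2 * (4 * d%:R * L * gamma) * (d%:R + 1) * B); first by field.
  by rewrite dLg; ring.
have : (d%:R + 1) * B <= 2 * d%:R * B by rewrite ler_wpM2r//; lra.
have : 0 <= d%:R * (L ^+ 2 * tau ^+ 2) by rewrite mulr_ge0.
rewrite -(mulrA d%:R (L ^+ 2)) -(mulrA d%:R (Delta ^+ 2)) /B.
move: (_ / N.+1%:R) (L ^+ 2 * _) (Delta ^+ 2 / _) => X Y Z.
lra.
Qed.
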